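(* Assume $p_{\mathrm{sample}}=O(1/\sqrt n)$, $p_{\mathrm{vote}}=O(\mathrm{polylog}(n)/n)$ and $p_{\mathrm{prop}}=O(1/n)$. Then in the best case, in each epoch of the QScale protocol, the leader and the members of the first-layer random sample each send an expected $O(\sqrt n)$ messages, each remaining process sends $O(1)$ messages in expectation, and the expected total number of messages sent in the epoch is $$n\,p_{\mathrm{sample}}+(n\,p_{\mathrm{sample}})^2+n\,p_{\mathrm{vote}}+3n^2p_{\mathrm{prop}}=O(n).$$ Consequently the expected total message complexity per block is $O(\kappa n)$, and, with multi-signatures and $q=O(\mathrm{polylog}(n))$ votes per certificate, the expected total communication complexity per block is $O(\kappa\, n\cdot \mathrm{polylog}(n))=\widetilde O(\kappa n)$.
   Context: $\Pi$ is a set of $n$ processes. QScale runs in epochs of three rounds, each epoch having a designated leader. A random sample with probability $p$ contains each process independently with probability $p$, and all samples and coins are independent. In the propose round, the leader sends its proposal to a random sample with probability $p_{\mathrm{sample}}$ (the first-layer sample). In the disseminate round, each member of the first-layer sample forwards the proposal to its own fresh random sample with probability $p_{\mathrm{sample}}$. In the vote round, each process that received the proposal sends, with probability $p_{\mathrm{vote}}$, one vote to the leader of the next epoch. In addition, in each of the three rounds every process sends the most recent proposal it has to a fresh random sample with probability $p_{\mathrm{prop}}$ (propagation). (The paper's count does not include the single extra copies of the proposal sent to the next leader.) A block proposal carries a certificate, which is a multi-signature aggregating $q$ votes, of size $O(\mathrm{polylog}(n))$; communication is measured by charging each message the size of a multi-signature. ''Per block'' means over the $\kappa$ epochs needed in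 the best case to commit a block; ''best case'' means all processes follow the protocol. $\widetilde O$ hides polylogarithmic factors in $n$.
   Formalization: The exact total with the term n·p_vote is stated when every process has received the proposal by the vote round; in general n·p_vote is replaced by p_vote times the expected number of processes that received it, and the formula is an upper bound. *)

(* Defs.v *)
(* MathComp / MathComp-Analysis *)
From HB Require Import structures.
From mathcomp Require Import all_boot all_order all_algebra.
From mathcomp Require Import all_classical all_reals all_analysis.

Set Implicit Arguments.
Unset Strict Implicit.
Unset Printing Implicit Defensive.

Import Order.TTheory GRing.Theory Num.Theory.
Import numFieldNormedType.Exports.

Local Open Scope ring_scope.

(* Processes are the elements of 'I_n.  The coins of one epoch:
   - FirstLayer j    : j belongs to the sample drawn by the leader;
   - SecondLayer i j : j belongs to the sample that i draws if it has to
                       disseminate (the coin is ignored otherwise);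
   - Vote i          : i votes, provided it received the proposal;
   - Propagate r i j : j belongs to the propagation sample of i in round r.
   Samples range over all n processes, the sender included. *)
Inductive coin (n : nat) : Type :=
  | FirstLayer of 'I_n
  | SecondLayer of 'I_n & 'I_n
  | Vote of 'I_n
  | Propagate of 'I_3 & 'I_n & 'I_n.

Arguments FirstLayer {n}.
Arguments SecondLayer {n}.
Arguments Vote {n}.
Arguments Propagate {n}.

Section CoinFinite.
Variable n : nat.

Let code := ('I_n + 'I_n * 'I_n + 'I_n + 'I_3 * 'I_n * 'I_n)%type.

Definition coin_encode (c : coin n) : code :=
  match c with
  | FirstLayer j => inl (inl (inl j))
  | SecondLayer i j => inl (inl (inr (i, j)))
  | Vote i => inl (inr i)
  | Propagate r i j => inr (r, i, j)
  end.

Definition coin_decode (s : code) : coin n :=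
  match s with
  | inl (inl (inl j)) => FirstLayer j
  | inl (inl (inr (i, j))) => SecondLayer i j
  | inl (inr i) => Vote i
  | inr (r, i, j) => Propagate r i j
  end.

Lemma coin_encodeK : cancel coin_encode coin_decode.
Proof. by case. Qed.

HB.instance Definition _ := Finite.copy (coin n) (can_type coin_encodeK).

End CoinFinite.

Record probs (R : realType) := Probs {
  p_sample : R;
  p_vote : R;
  p_prop : R
}.

Definition valid_probs (R : realType) (p : probs R) : Prop :=
  [/\ 0 <= p_sample p <= 1, 0 <= p_vote p <= 1 & 0 <= p_prop p <= 1].

Definition coin_prob (R : realType) (p : probs R) (n : nat) (c : coin n) : R :=
  match c with
  | FirstLayer _ | SecondLayer _ _ => p_sample p
  | Vote _ => p_vote p
  | Propagate _ _ _ => p_prop p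
  end.

(* Outcome of all the coins of K consecutive epochs. *)
Definition outcome (n K : nat) := {ffun 'I_K * coin n -> bool}.

(* Product law: all the coins are independent. *)
Definition outcome_prob (R : realType) (p : probs R) (n K : nat)
    (w : outcome n K) : R :=
  \prod_(x : 'I_K * coin n)
    (if w x then coin_prob p x.2 else 1 - coin_prob p x.2).

Definition expect (R : realType) (p : probs R) (n K : nat)
    (f : outcome n K -> R) : R :=
  \sum_(w : outcome n K) outcome_prob p w * f w.

(* E[f | A]; equal to 0 when A has probability 0. *)
Definition cond_expect (R : realType) (p : probs R) (n K : nat)
    (f : outcome n K -> R) (A : pred (outcome n K)) : R :=
  expect p (fun w => f w * (A w)%:R) / expect p (fun w => (A w)%:R).

(* [received e w] is the set of processes that have received the proposal of
   epoch e by its vote round.  Which of the copies (of either layer or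
   propagated) have arrived by then is not specified: the set is an arbitrary
   function of the outcome, except that it cannot depend on the vote coins of
   the same epoch, which are tossed afterwards. *)
Record execution (n K : nat) := Execution {
  leader : 'I_K -> 'I_n;
  received : 'I_K -> outcome n K -> {set 'I_n};
  received_before_vote : forall (e : 'I_K) (w w' : outcome n K),
    (forall y : 'I_K * coin n, (forall i : 'I_n, y <> (e, Vote i)) ->
       w y = w' y) ->
    received e w = received e w'
}.

Section Messages.
Variables (n K : nat) (x : execution n K).
Implicit Types (e : 'I_K) (i : 'I_n) (w : outcome n K).

Definition first_layer e w : {set 'I_n} := [set j | w (e, FirstLayer j)].

Definition second_layer e i w : {set 'I_n} := [set j | w (e, SecondLayer i j)].

Definition propagation e (r : 'I_3) i w : {set 'I_n} :=
  [set j | w (e, Propagate r i j)].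

Definition propose_msgs e i w : nat :=
  if i == leader x e then #|first_layer e w| else 0%N.

Definition disseminate_msgs e i w : nat :=
  if i \in first_layer e w then #|second_layer e i w| else 0%N.

Definition vote_msgs e i w : nat :=
  (i \in received x e w) && w (e, Vote i).

(* Every process always has some most recent proposal, so it propagates in
   each of the three rounds. *)
Definition propagation_msgs e i w : nat :=
  (\sum_(r < 3) #|propagation e r i w|)%N.

Definition sent e i w : nat :=
  (propose_msgs e i w + disseminate_msgs e i w + vote_msgs e i w
    + propagation_msgs e i w)%N.

Definition epoch_messages e w : nat := (\sum_(i < n) sent e i w)%N.

(* When K is the number of epochs needed to commit a block. *)
Definition block_messages w : nat := (\sum_(e < K) epoch_messages e w)%N.

(* Every message is charged the size of a multi-signature. *)
Definition block_communication (sig_size : nat) w : nat :=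
  (block_messages w * sig_size)%N.

(* In every outcome of positive probability, every process has received the
   proposal of epoch e by its vote round. *)
Definition all_receive (R : realType) (p : probs R) e : Prop :=
  forall w, 0 < outcome_prob p w -> forall i, i \in received x e w.

End Messages.

Definition epoch_formula (R : realType) (p : probs R) (n : nat) : R :=
  n%:R * p_sample p + (n%:R * p_sample p) ^+ 2 + n%:R * p_vote p
    + 3 * n%:R ^+ 2 * p_prop p.

Local Open Scope classical_set_scope.

(* f = O(polylog(n) * g) *)
Definition bigO_polylog (R : realType) (f g : nat -> R) : Prop :=
  exists k : nat, f =O_\oo (fun n : nat => (ln (n%:R : R)) ^+ k * g n).

(* Main.v *)
Require Import Defs.
From HB Require Import structures.
From mathcomp Require Import all_boot all_order all_algebra.
From mathcomp Require Import all_classical all_reals all_analysis.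
From mathcomp Require Import ring lra.

Import Order.TTheory GRing.Theory Num.Theory.
Import numFieldNormedType.Exports.

Local Open Scope classical_set_scope.
Local Open Scope ring_scope.

(** The messages of a process are sums of products of independent coins, so
    linearity of expectation reduces every count to one fact: a coin that a
    random variable ignores factors out of the expectation.  Whether a process
    has received the proposal is correlated with all earlier coins, but not
    with its own vote coin.  Conditioning on the membership of [i] in the
    first layer biases only the coin [FirstLayer i]; this costs one extra
    message when the leader samples itself. *)

Set Implicit Arguments.
Unset Strict Implicit.
Unset Printing Implicit Defensive.

(** * Expectation under the product law of the coins *)

Section Expectation.
Context {R : realType} {n K : nat}.
Implicit Types (p : probs R) (w : outcome n K) (y : 'I_K * coin n).
Implicit Types f g : outcome n K -> R.

(** Pointwise substitute for independence from the single coin [y]. The codomain is arbitrary so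
    that it also applies to the set-valued [received]. *)
Definition ignores (T : Type) (f : outcome n K -> T) y :=
  forall w w', (forall z, z <> y -> w z = w' z) -> f w = f w'.

Lemma coin_prob_itv p (c : coin n) : valid_probs p -> 0 <= coin_prob p c <= 1.
Proof. by case=> ? ? ?; case: c. Qed.

Lemma outcome_prob_ge0 p w : valid_probs p -> 0 <= outcome_prob p w.
Proof.
move=> pv; apply: prodr_ge0 => y _.
have /andP[c0 c1] := coin_prob_itv y.2 pv.
by case: ifP => // _; rewrite subr_ge0.
Qed.

Lemma eq_expect p f g : f =1 g -> expect p f = expect p g.
Proof. by move=> fg; apply: eq_bigr => w _; rewrite fg. Qed.

Lemma expectD p f g :
  expect p (fun w => f w + g w) = expect p f + expect p g.
Proof. by rewrite -big_split; apply: eq_bigr => w _; rewrite mulrDr. Qed.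

Lemma expectZ p a f : expect p (fun w => a * f w) = a * expect p f.
Proof. by rewrite mulr_sumr; apply: eq_bigr => w _; rewrite mulrCA. Qed.

Lemma expect_sum p (I : finType) (F : I -> outcome n K -> R) :
  expect p (fun w => \sum_i F i w) = \sum_i expect p (F i).
Proof.
by rewrite [RHS]exchange_big; apply: eq_bigr => w _; rewrite mulr_sumr.
Qed.

Lemma ler_expect p f g : valid_probs p -> (forall w, f w <= g w) ->
  expect p f <= expect p g.
Proof.
by move=> pv fg; apply: ler_sum => w _; rewrite ler_wpM2l ?outcome_prob_ge0.
Qed.

Lemma expect_ge0 p f : valid_probs p -> (forall w, 0 <= f w) ->
  0 <= expect p f.
Proof.
by move=> pv f0; apply: sumr_ge0 => w _; rewrite mulr_ge0 ?outcome_prob_ge0.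
Qed.

Lemma expect1 p : expect p (fun _ : outcome n K => 1) = 1.
Proof.
rewrite /expect; under eq_bigr do rewrite mulr1.
(* Distributivity: the sum over outcomes of products over coins is the product over coins of
   [c + (1 - c)]. *)
rewrite -(bigA_distr_bigA (fun (y : 'I_K * coin n) (b : bool) =>
  if b then coin_prob p y.2 else 1 - coin_prob p y.2)) /=.
by rewrite big1 // => y _; rewrite big_bool /= addrC subrK.
Qed.

Definition flip y w : outcome n K :=
  [ffun z => if z == y then ~~ w z else w z].

Lemma flipK y : involutive (flip y).
Proof.
by move=> w; apply/ffunP=> z; rewrite !ffunE; case: eqP => // _; rewrite negbK.
Qed.

(** Pair each outcome with its flip at [y]. Both give the same value of [f] and the same weight [P]
    to the other coins, while the two weights of [y] add up to 1. Hence [expect p f] is the sum of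
    [P w * f w] over the outcomes with [w y], and the left side is this sum times the probability of
    [y]. *)
Lemma expect_mul_coin p f y : ignores f y ->
  expect p (fun w => f w * (w y)%:R) = expect p f * coin_prob p y.2.
Proof.
move=> fy.
pose P w := \prod_(z | z != y)
  (if w z then coin_prob p z.2 else 1 - coin_prob p z.2).
have PE w : outcome_prob p w =
    (if w y then coin_prob p y.2 else 1 - coin_prob p y.2) * P w.
  by rewrite /outcome_prob (bigD1 y).
have flipy w : f (flip y w) = f w.
  by apply: fy => z /eqP/negPf zy; rewrite ffunE zy.
have flipP w : P (flip y w) = P w.
  by apply: eq_bigr => z /negPf zy; rewrite ffunE zy.
rewrite /expect [in LHS](bigID (fun w => w y)) /=.
rewrite [X in _ + X]big1 ?addr0; last first.
  by move=> w /negPf ->; rewrite !mulr0.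
rewrite [in RHS](bigID (fun w => w y)) /=.
(* On the right, flipping carries the outcomes where [y] fails onto those where it holds, so both
   halves range over the same index set. *)
rewrite [X in _ + X](reindex_inj (inv_inj (flipK y))) /=.
rewrite [X in _ + X](eq_bigl (fun w : outcome n K => w y)); last first.
  by move=> w; rewrite ffunE eqxx negbK.
rewrite -big_split mulr_suml; apply: eq_bigr => w wy /=.
rewrite !PE flipP flipy ffunE eqxx wy /=; ring.
Qed.

Lemma expect_coin p y : expect p (fun w => (w y)%:R) = coin_prob p y.2.
Proof.
have /= := @expect_mul_coin p (fun=> 1) y (fun _ _ _ => erefl).
by rewrite expect1 mul1r; under eq_expect => w do rewrite mul1r.
Qed.

(** The assumption [0 <= c] covers an event of probability 0, where the quotient is 0 by convention;
    otherwise one clears the denominator. *)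
Lemma cond_expect_le p f (A : pred (outcome n K)) c : valid_probs p -> 0 <= c ->
  expect p (fun w => f w * (A w)%:R) <= c * expect p (fun w => (A w)%:R) ->
  cond_expect p f A <= c.
Proof.
move=> pv c0 fA; rewrite /cond_expect.
have : 0 <= expect p (fun w => (A w)%:R) by apply: expect_ge0.
by rewrite le0r => /predU1P[->|A0]; rewrite ?invr0 ?mulr0 // ler_pdivrMr.
Qed.

End Expectation.

(** * Messages sent within one epoch *)

Section Epoch.
Context {R : realType} {n K : nat}.
Variables (p : probs R) (x : execution n K) (e : 'I_K).
Implicit Types (i j : 'I_n) (w : outcome n K).

Lemma cardR (T : finType) (A : {set T}) :
  #|A|%:R = \sum_j (j \in A)%:R :> R.
Proof.
by rewrite -sum1_card natr_sum big_mkcond; apply: eq_bigr => j _; case: ifP.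
Qed.

Lemma sum_ord_const m (a : R) : \sum_(i < m) a = m%:R * a.
Proof. by rewrite sumr_const card_ord mulr_natl. Qed.

(** Cardinalities become sums of coins, each multiplied at most by a factor ignoring it, which is
    the shape that [expect_mul_coin] needs. *)
Lemma sentE i w : (sent x e i w)%:R =
  (i == leader x e)%:R * (\sum_j (w (e, FirstLayer j))%:R)
  + \sum_j ((w (e, FirstLayer i))%:R * (w (e, SecondLayer i j))%:R)
  + (i \in received x e w)%:R * (w (e, Vote i))%:R
  + \sum_(r < 3) \sum_j (w (e, Propagate r i j))%:R :> R.
Proof.
rewrite /sent !natrD; congr (_ + _ + _ + _).
- rewrite /propose_msgs; case: eqP => _; rewrite ?mul0r // mul1r cardR.
  by apply: eq_bigr => j _; rewrite inE.
- rewrite /disseminate_msgs inE -mulr_sumr; case: ifP => _; rewrite ?mul0r //.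
  by rewrite mul1r cardR; apply: eq_bigr => j _; rewrite inE.
- by rewrite /vote_msgs -natrM mulnb.
- rewrite /propagation_msgs natr_sum; apply: eq_bigr => r _; rewrite cardR.
  by apply: eq_bigr => j _; rewrite inE.
Qed.

Lemma ignores_received i : ignores (received x e) (e, Vote i).
Proof. by move=> w w' ww'; apply: received_before_vote => y yi; apply: ww'. Qed.

Lemma expect_sent i : expect p (fun w => (sent x e i w)%:R) =
  (i == leader x e)%:R * (n%:R * p_sample p) + n%:R * p_sample p ^+ 2
  + expect p (fun w => (i \in received x e w)%:R) * p_vote p
  + 3 * n%:R * p_prop p.
Proof.
rewrite (eq_expect _ (sentE i)) !expectD expectZ !expect_sum.
congr (_ * _ + _ + _ + _).
- rewrite (eq_bigr (fun=> p_sample p)) => [|j _]; last exact: expect_coin.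
  exact: sum_ord_const.
- rewrite (eq_bigr (fun=> p_sample p ^+ 2)) => [|j _]; first exact: sum_ord_const.
  by rewrite expect_mul_coin ?expect_coin // => w w' ->.
- by rewrite expect_mul_coin // => w w' /ignores_received ->.
- transitivity (\sum_(r < 3) \sum_(j < n) p_prop p).
    apply: eq_bigr => r _; rewrite expect_sum.
    by apply: eq_bigr => j _; exact: expect_coin.
  by rewrite !sum_ord_const !mulrA.
Qed.

(** Summed over the senders, the leader indicator counts once, and the [n] disseminating terms
    [n * p_sample ^ 2] make up the square. The expected size of [received] stays, since an execution
    leaves that set unspecified. *)
Lemma expect_epoch_messages :
  expect p (fun w => (epoch_messages x e w)%:R) =
  n%:R * p_sample p + (n%:R * p_sample p) ^+ 2
  + expect p (fun w => #|received x e w|%:R) * p_vote p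
  + 3 * n%:R ^+ 2 * p_prop p.
Proof.
under eq_expect => w do rewrite natr_sum.
under [in RHS]eq_expect => w do rewrite cardR.
rewrite !expect_sum.
under eq_bigr do rewrite expect_sent.
have lead1 : \sum_(i < n) (i == leader x e)%:R = 1 :> R.
  by rewrite (bigD1 (leader x e)) //= eqxx big1 ?addr0 // => i /negPf ->.
rewrite !big_split /= -!mulr_suml lead1 !sum_ord_const; ring.
Qed.

Hypothesis pv : valid_probs p.

(* The three choices [h = 1], [h b = b] and [h b = ~~ b] give the unconditional
   bound and the two conditional ones. *)
Lemma expect_sent_weighted_le i (h : bool -> R) : (forall b, 0 <= h b) ->
  expect p (fun w => (sent x e i w)%:R * h (w (e, FirstLayer i))) <=
  ((i == leader x e)%:R * (1 + n%:R * p_sample p) + 1 + 3 * n%:R * p_prop p)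
    * expect p (fun w : outcome n K => h (w (e, FirstLayer i)))
  + n%:R * p_sample p
    * expect p (fun w => (w (e, FirstLayer i))%:R * h (w (e, FirstLayer i))).
Proof.
move=> h0; pose g w := h (w (e, FirstLayer i)).
change (expect p (fun w => (sent x e i w)%:R * g w) <=
  ((i == leader x e)%:R * (1 + n%:R * p_sample p) + 1 + 3 * n%:R * p_prop p)
    * expect p g
  + n%:R * p_sample p * expect p (fun w => (w (e, FirstLayer i))%:R * g w)).
have [/andP[s0 s1] _ /andP[r0 r1]] := pv.
have g0 w : 0 <= g w by exact: h0.
have Eg0 : 0 <= expect p g by exact: expect_ge0.
have ig c : c <> FirstLayer i -> ignores g (e, c).
  by move=> ci w w' ww'; rewrite /g ww' // => -[/esym].
rewrite (@eq_expect _ _ _ _ _ (fun w => (i == leader x e)%:R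
     * (\sum_j (g w * (w (e, FirstLayer j))%:R))
  + \sum_j ((w (e, FirstLayer i))%:R * g w * (w (e, SecondLayer i j))%:R)
  + ((i \in received x e w)%:R * (w (e, Vote i))%:R * g w)
  + \sum_(r < 3) \sum_j (g w * (w (e, Propagate r i j))%:R))); last first.
  move=> w; rewrite sentE !mulrDl -!mulrA; congr (_ * _ + _ + _ + _).
  - by rewrite mulrC mulr_sumr.
  - by rewrite mulr_suml; apply: eq_bigr => j _; rewrite mulrAC.
  - rewrite mulrC mulr_sumr; apply: eq_bigr => r _.
    by rewrite mulr_sumr.
rewrite !expectD expectZ !expect_sum.
(* The second-layer coins factor out, but the indicator of [FirstLayer i] must stay with [g], which
   depends on the same coin. *)
have -> : \sum_j expect p (fun w =>
    (w (e, FirstLayer i))%:R * g w * (w (e, SecondLayer i j))%:R) =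
    n%:R * p_sample p * expect p (fun w => (w (e, FirstLayer i))%:R * g w).
  rewrite -mulrA -sum_ord_const.
  apply: eq_bigr => j _; rewrite expect_mul_coin 1?mulrC // => w w' ww'.
  by rewrite /g ww'.
have -> : \sum_(r < 3) expect p (fun w =>
    \sum_j g w * (w (e, Propagate r i j))%:R) = 3 * n%:R * p_prop p * expect p g.
  transitivity (\sum_(r < 3) \sum_(j < n) expect p g * p_prop p).
    apply: eq_bigr => r _; rewrite expect_sum.
    by apply: eq_bigr => j _; apply: expect_mul_coin; apply: ig.
  rewrite !sum_ord_const; ring.
(* A process casts at most one vote; this is the isolated [1] in the bound. *)
have vle : expect p (fun w =>
    (i \in received x e w)%:R * (w (e, Vote i))%:R * g w) <= expect p g.
  apply: ler_expect => // w; rewrite -natrM mulnb ler_piMl //.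
  by case: (_ && _).
(* Only the term [j = i] fails to factor; it is at most [expect p g]. The sum over the other [j] is
   then enlarged to all [n] indices. *)
have fle : \sum_j expect p (fun w => g w * (w (e, FirstLayer j))%:R) <=
    (1 + n%:R * p_sample p) * expect p g.
  rewrite mulrDl mul1r (bigD1 i) //= lerD //.
    by apply: ler_expect => // w; rewrite ler_piMr //; case: (w _).
  apply: (@le_trans _ _ (\sum_(j < n | j != i) expect p g * p_sample p)).
    apply: ler_sum => j /eqP ji; rewrite expect_mul_coin //.
    by apply: ig => -[].
  rewrite big_mkcond /=.
  apply: (@le_trans _ _ (\sum_(j < n) expect p g * p_sample p)).
    by apply: ler_sum => j _; case: ifP => // _; rewrite mulr_ge0.
  by rewrite sum_ord_const (mulrC (expect p g)) mulrA.
have := ler_wpM2l (ler0n R (i == leader x e)) fle.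
lra.
Qed.

Lemma expect_received_le :
  expect p (fun w => #|received x e w|%:R) <= n%:R.
Proof.
rewrite -[leRHS]mulr1 -[X in _ <= _ * X](@expect1 R n K p) -expectZ.
by apply: ler_expect => // w; rewrite mulr1 ler_nat -[leqRHS]card_ord max_card.
Qed.

Lemma expect_received_all : all_receive x p e ->
  expect p (fun w => #|received x e w|%:R) = n%:R.
Proof.
move=> xall; rewrite -[RHS]mulr1 -[X in _ = _ * X](@expect1 R n K p) -expectZ.
apply: eq_bigr => w _; have := outcome_prob_ge0 w pv.
(* [all_receive] says nothing about outcomes of probability 0, but these have weight 0 on both
   sides. *)
rewrite le0r => /predU1P[->|w0]; first by rewrite !mul0r.
congr (_ * _); rewrite mulr1; congr (_%:R).
by rewrite -[RHS](card_ord n); apply: eq_card => i; rewrite (xall w w0 i).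
Qed.

Lemma expect_epoch_messages_le :
  expect p (fun w => (epoch_messages x e w)%:R) <= epoch_formula p n.
Proof.
have [_ /andP[v0 _] _] := pv.
by rewrite expect_epoch_messages /epoch_formula lerD2r lerD2l ler_wpM2r
  ?expect_received_le.
Qed.

End Epoch.

(** * Bounds per block and asymptotics *)

Lemma expect_block_messages_le {R : realType} (p : probs R) (n K : nat)
    (x : execution n K) : valid_probs p ->
  expect p (fun w => (block_messages x w)%:R) <= K%:R * epoch_formula p n.
Proof.
move=> pv; under eq_expect => w do rewrite natr_sum.
rewrite expect_sum -sum_ord_const.
by apply: ler_sum => e _; apply: expect_epoch_messages_le.
Qed.

Lemma epoch_formula_ge0 {R : realType} (p : probs R) (n : nat) :
  valid_probs p -> 0 <= epoch_formula p n.
Proof.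
by case=> /andP[? _] /andP[? _] /andP[? _]; rewrite /epoch_formula;
  rewrite !addr_ge0 // !mulr_ge0 ?exprn_ge0 ?mulr_ge0.
Qed.

Lemma sampleO_bound {R : realType} (s : nat -> R) :
  s =O_\oo (fun n : nat => (Num.sqrt (n%:R : R))^-1) ->
  exists2 C, 0 < C & \forall n \near \oo, n%:R * s n <= C * Num.sqrt n%:R.
Proof.
move=> /eqO_exP[C C0 sC]; exists C => //; near=> n.
have n0 : 0 < n%:R :> R by rewrite ltr0n; near: n; exists 1%N.
have sn0 : 0 < Num.sqrt n%:R :> R by rewrite sqrtr_gt0.
have : `|s n| <= C * `|(Num.sqrt (n%:R : R))^-1| by near: n.
rewrite [X in C * X]gtr0_norm ?invr_gt0 // => h.
have {h} := le_trans (ler_norm (s n)) h.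
rewrite ler_pdivlMr // => h.
(* Writing [n] as the square of its root lets one root cancel. *)
rewrite -{1}(sqr_sqrtr (ltW n0)) expr2 -mulrA mulrC ler_pM2r //.
by rewrite mulrC.
Unshelve. all: by end_near. Qed.

Lemma propO_bound {R : realType} (s : nat -> R) :
  s =O_\oo (fun n : nat => (n%:R : R)^-1) ->
  exists2 C, 0 < C & \forall n \near \oo, n%:R * s n <= C.
Proof.
move=> /eqO_exP[C C0 sC]; exists C => //; near=> n.
have n0 : 0 < n%:R :> R by rewrite ltr0n; near: n; exists 1%N.
have : `|s n| <= C * `|(n%:R : R)^-1| by near: n.
rewrite [X in C * X]gtr0_norm ?invr_gt0 // => h.
have {h} := le_trans (ler_norm (s n)) h.
by rewrite ler_pdivlMr // mulrC.
Unshelve. all: by end_near. Qed.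

Lemma epoch_formula_linear {R : realType} (p : nat -> probs R) :
  (forall n, valid_probs (p n)) ->
  (fun n : nat => p_sample (p n))
    =O_\oo (fun n : nat => (Num.sqrt (n%:R : R))^-1) ->
  (fun n : nat => p_prop (p n)) =O_\oo (fun n : nat => (n%:R : R)^-1) ->
  exists2 C, 0 < C & \forall n \near \oo, epoch_formula (p n) n <= C * n%:R.
Proof.
move=> pv /sampleO_bound[S S0 sS] /propO_bound[C C0 pC].
(* One summand per term of the formula: first layer (a root of [n] is at most [n]), second layer,
   votes ([p_vote] is at most 1), and propagation. *)
exists (S + S ^+ 2 + 1 + 3 * C); first by rewrite !addr_gt0 // mulr_gt0.
near=> n.
have n1 : 1 <= n%:R :> R by rewrite ler1n; near: n; exists 1%N.
have n0 : 0 <= n%:R :> R by [].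
have [/andP[s0 s1] /andP[v0 v1] /andP[r0 r1]] := pv n.
have hs : n%:R * p_sample (p n) <= S * Num.sqrt n%:R by near: n.
have hp : n%:R * p_prop (p n) <= C by near: n.
have hs2 : (n%:R * p_sample (p n)) ^+ 2 <= S ^+ 2 * n%:R.
  rewrite -[in leRHS](sqr_sqrtr n0) -exprMn ler_sqr ?nnegrE ?mulr_ge0 //.
  exact: ltW.
have hs1 : n%:R * p_sample (p n) <= S * n%:R.
  apply: (le_trans hs); rewrite ler_pM2l //.
  rewrite -[leRHS]ger0_norm // -sqrtr_sqr ler_sqrt ?sqr_ge0 //.
  by rewrite expr2 ler_peMl.
have hv : n%:R * p_vote (p n) <= n%:R by rewrite ler_piMr.
have := ler_wpM2l n0 hp; rewrite /epoch_formula expr2; lra.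
Unshelve. all: by end_near. Qed.

Unset Implicit Arguments.

Theorem mainTheorem4 (R : realType) (p : nat -> probs R)
    (q : nat -> nat) (multisig_size : nat -> nat -> nat)
    (p_valid : forall n : nat, valid_probs (p n))
    (p_sampleO : (fun n : nat => p_sample (p n))
                   =O_\oo (fun n : nat => (Num.sqrt (n%:R : R))^-1))
    (p_voteO : bigO_polylog (fun n : nat => p_vote (p n))
                            (fun n : nat => (n%:R : R)^-1))
    (p_propO : (fun n : nat => p_prop (p n))
                 =O_\oo (fun n : nat => (n%:R : R)^-1))
    (qO : bigO_polylog (fun n : nat => (q n)%:R : R) (fun=> 1))
    (* multisig_size n m: size, for n processes, of the aggregate of m votes *)
    (multisig_sizeO :
       bigO_polylog (fun n : nat => (multisig_size n (q n))%:R : R) (fun=> 1)) :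
  (* the leader and the members of the first-layer sample *)
  (exists C : R, \forall n \near \oo,
     forall (K : nat) (x : execution n K) (e : 'I_K),
       expect (p n) (fun w => (sent x e (leader x e) w)%:R)
         <= C * Num.sqrt n%:R /\
       forall i : 'I_n,
         cond_expect (p n) (fun w => (sent x e i w)%:R)
           (fun w => i \in first_layer e w)
         <= C * Num.sqrt n%:R) /\
  (* the remaining processes *)
  (exists C : R, \forall n \near \oo,
     forall (K : nat) (x : execution n K) (e : 'I_K) (i : 'I_n),
       i != leader x e ->
       cond_expect (p n) (fun w => (sent x e i w)%:R)
         (fun w => i \notin first_layer e w)
       <= C) /\
  (* total number of messages in an epoch *)
  (forall (n K : nat) (x : execution n K) (e : 'I_K),
     let total := expect (p n) (fun w => (epoch_messages x e w)%:R) in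
     [/\ all_receive x (p n) e -> total = epoch_formula (p n) n,
         total = n%:R * p_sample (p n) + (n%:R * p_sample (p n)) ^+ 2
           + expect (p n) (fun w => #|received x e w|%:R) * p_vote (p n)
           + 3 * n%:R ^+ 2 * p_prop (p n)
       & total <= epoch_formula (p n) n]) /\
  ((fun n : nat => epoch_formula (p n) n) =O_\oo (fun n : nat => n%:R : R)) /\
  (* per block *)
  (exists C : R, \forall n \near \oo,
     forall (kappa : nat) (x : execution n kappa),
       expect (p n) (fun w => (block_messages x w)%:R)
       <= C * (kappa%:R * n%:R)) /\
  (exists (C : R) (k : nat), \forall n \near \oo,
     forall (kappa : nat) (x : execution n kappa),
       expect (p n)
         (fun w => (block_communication x (multisig_size n (q n)) w)%:R)
       <= C * (kappa%:R * n%:R * ln (n%:R : R) ^+ k)).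
Proof.
have [S S0 sS] := sampleO_bound p_sampleO.
have [P P0 pP] := propO_bound p_propO.
have [L L0 fL] := epoch_formula_linear p_valid p_sampleO p_propO.
split; [|split; [|split; [|split; [|split]]]].
(* This dominates [2 + 2 * (n * p_sample) + 3 * (n * p_prop)] after division by the root of [n],
   which is at least 1. *)
- exists (2 * S + 2 + 3 * P); near=> n => K x e.
  have n1 : 1 <= n%:R :> R by rewrite ler1n; near: n; exists 1%N.
  have sn1 : 1 <= Num.sqrt n%:R :> R by rewrite -[leLHS]sqrtr1 ler_wsqrtr.
  have hs : n%:R * p_sample (p n) <= S * Num.sqrt n%:R by near: n.
  have hp : n%:R * p_prop (p n) <= P by near: n.
  have [/andP[s0 s1] _ /andP[r0 r1]] := p_valid n.
  have s0' : 0 <= n%:R * p_sample (p n) by rewrite mulr_ge0.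
  have r0' : 0 <= n%:R * p_prop (p n) by rewrite mulr_ge0.
  have hP : P <= P * Num.sqrt n%:R by rewrite ler_peMr // ltW.
  have weighted i (h : bool -> R) : (forall b, 0 <= h b) ->
      expect (p n) (fun w => (sent x e i w)%:R * h (w (e, FirstLayer i))) <=
      (2 * S + 2 + 3 * P) * Num.sqrt n%:R
        * expect (p n) (fun w => h (w (e, FirstLayer i))).
    move=> h0; apply: le_trans (expect_sent_weighted_le x e (p_valid n) i h0) _.
    set E := expect _ _; set F := expect _ _.
    have E0 : 0 <= E by apply: expect_ge0.
    have FE : F <= E.
      by apply: ler_expect => // w; rewrite ler_piMl //; case: (w _).
    (* The worst case is a leader that is also in the first layer: it draws two samples, and the
       vote and the biased coin [FirstLayer i] add 1 each. *)
    apply: (@le_trans _ _ ((2 + 2 * (n%:R * p_sample (p n))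
        + 3 * (n%:R * p_prop (p n))) * E)).
      have := ler_wpM2l s0' FE.
      have := mulr_ge0 s0' E0.
      by case: (i == _) => /=; lra.
    by rewrite ler_wpM2r //; lra.
  split.
    (* The constant weight 1 gives the unconditional bound for the leader; the identity weight below
       gives the bound conditional on membership. *)
    have := weighted (leader x e) (fun=> 1) (fun=> ler01).
    by under eq_expect => w do rewrite mulr1; rewrite expect1 mulr1.
  move=> i; apply: cond_expect_le => //.
    by rewrite mulr_ge0 ?(le_trans _ sn1) //; lra.
  under eq_expect => w do rewrite inE.
  under [in leRHS]eq_expect => w do rewrite inE.
  exact: (weighted i (fun b => b%:R)).
(* One vote, and three propagation rounds of at most [P] expected messages each. *)
- exists (1 + 3 * P); near=> n => K x e i il.
  have hp : n%:R * p_prop (p n) <= P by near: n.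
  apply: cond_expect_le => //; first lra.
  under eq_expect => w do rewrite inE.
  under [in leRHS]eq_expect => w do rewrite inE.
  have h0 (b : bool) : 0 <= (~~ b)%:R :> R by [].
  apply: le_trans (expect_sent_weighted_le x e (p_valid n) i h0) _.
  rewrite (negPf il) mul0r add0r.
  (* With weight [~~ b] the dissemination term vanishes, as [b] and [~~ b] are never both true. *)
  rewrite [X in _ + _ * X]big1 => [|w _]; last first.
    by case: (w _); rewrite /= ?mul0r ?mulr0.
  by rewrite mulr0 addr0 ler_wpM2r ?expect_ge0 //; lra.
- move=> n K x e; split.
  + by move=> xall; rewrite expect_epoch_messages expect_received_all.
  + exact: expect_epoch_messages.
  + exact: expect_epoch_messages_le.
- apply/eqO_exP; exists L => //; near=> n.
  by rewrite !ger0_norm ?epoch_formula_ge0 //; near: n.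
(* [L] bounds one epoch and does not depend on [kappa], so the bound is uniform in the number of
   epochs. *)
- exists L; near=> n => kappa x.
  apply: le_trans (expect_block_messages_le x (p_valid n)) _.
  by rewrite mulrCA ler_wpM2l //; near: n.
- have [k /eqO_exP[M M0 hM]] := multisig_sizeO.
  exists (L * M), k; near=> n => kappa x.
  have n1 : 1 <= n%:R :> R by rewrite ler1n; near: n; exists 1%N.
  have m : (multisig_size n (q n))%:R <= M * ln (n%:R : R) ^+ k.
    have : `|(multisig_size n (q n))%:R| <= M * `|ln (n%:R : R) ^+ k * 1| by near: n.
    by rewrite mulr1 !ger0_norm ?exprn_ge0 // ln_ge0.
  have f : epoch_formula (p n) n <= L * n%:R by near: n.
  under eq_expect => w do rewrite natrM mulrC.
  rewrite expectZ.
  have b := expect_block_messages_le x (p_valid n).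
  apply: (@le_trans _ _ (M * ln n%:R ^+ k * (kappa%:R * (L * n%:R)))); last first.
    by rewrite le_eqVlt; apply/orP; left; apply/eqP; ring.
  apply: ler_pM => //; first exact: expect_ge0.
  by apply: (le_trans b); rewrite ler_wpM2l.
Unshelve. all: by end_near. Qed.
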